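(* Let $\mu$ be a symmetric Borel probability measure on $\mathbb{R}$ with finite variance and cumulative distribution function $F$. For a non-empty set $X\subset\{0,1\}^n$ and a number $\tau>0$, let $$G(X,\tau)=\ln|X|-\tau\,\Gamma(X,\mu),$$ and let $$g_\tau(a)=\ln(1+e^{-\tau a})-\tau\int_a^{+\infty}\bigl(1-F(t)\bigr)\,dt\quad\text{for } a\in\mathbb{R}.$$ Let $\tau>0$. (1) For every $n\ge 1$ and every non-empty set $X\subset\{0,1\}^n$, we have $$G(X,\tau)\le n\sup_{a\ge 0}g_\tau(a).$$ (2) Suppose that $$\sup_{a\ge 0}g_\tau(a)=g_\tau(a_0)>0\quad\text{for some (finite) } a_0\ge 0.$$ Then there exists a sequence $X_n=S(k_n,n)\subset\{0,1\}^n$ of Hamming spheres such that $$\lim_{n\to+\infty}\frac{G(X_n,\tau)}{n}=g_\tau(a_0).$$ Assuming moreover that $F$ is continuous and strictly increasing, one can choose $k_n=\alpha n+o(n)$ for $\alpha=1-F(a_0)$.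
   Context: A measure $\mu$ on $\mathbb{R}$ is symmetric if $\mu(A)=\mu(-A)$ for all Borel $A$. $F(t)=\mu((-\infty,t])$. $|X|$ is the cardinality of $X$. For a non-empty $X\subset\{0,1\}^n$, $$\Gamma(X,\mu)=\mathbf{E}\max_{x\in X}\langle c,x\rangle,$$ where $c=(\gamma_1,\ldots,\gamma_n)$ has independent coordinates with distribution $\mu$ and $\langle\cdot,\cdot\rangle$ is the standard scalar product in $\mathbb{R}^n$. The Hamming sphere $S(k,n)$ is the set of points $(\xi_1,\ldots,\xi_n)\in\{0,1\}^n$ with $\xi_1+\cdots+\xi_n=k$. *)

(* Defs.v *)
From HB Require Import structures.
From mathcomp Require Import all_boot all_order all_algebra.
From mathcomp Require Import all_classical all_reals all_analysis.

Set Implicit Arguments.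
Unset Strict Implicit.
Unset Printing Implicit Defensive.

Import Order.TTheory GRing.Theory Num.Theory.
Import numFieldNormedType.Exports.

Local Open Scope classical_set_scope.
Local Open Scope ring_scope.

Definition cons_pair d (T : measurableType d) (n : nat) (p : T * n.-tuple T) :
  n.+1.-tuple T := [tuple of p.1 :: p.2].

Lemma measurable_cons_pair d (T : measurableType d) (n : nat) :
  measurable_fun [set: T * n.-tuple T] (@cons_pair d T n).
Proof. exact: measurable_cons. Qed.

HB.instance Definition _ d (T : measurableType d) (n : nat) :=
  isMeasurableFun.Build _ _ _ _ (@cons_pair d T n)
    (@measurable_cons_pair d T n).

(* The n-fold product P (x) ... (x) P, i.e. the law of n independent
   coordinates with distribution P; see [power_prob_box]. *)
Fixpoint power_prob d (T : measurableType d) (R : realType)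
    (P : probability T R) (n : nat) : probability (n.-tuple T) R :=
  match n return probability (n.-tuple T) R with
  | 0 => \d_ ([tuple] : 0.-tuple T)
  | m.+1 => distribution (P \x power_prob P m)%E (@cons_pair d T m)
  end.

Lemma power_prob_box d (T : measurableType d) (R : realType)
    (P : probability T R) (n : nat) (A : 'I_n -> set T) :
  (forall i, measurable (A i)) ->
  power_prob P n [set c | forall i, A i (tnth c i)] =
  (\prod_(i < n) P (A i))%E.
Proof.
elim: n A => [|n IHn] A mA.
  by rewrite big_ord0 /= diracE mem_set//= => -[].
have mB : measurable
    [set c : n.-tuple T | forall i, A (lift ord0 i) (tnth c i)].
  rewrite (_ : [set _ | _] = \bigcap_(i in [set: 'I_n])
      ((fun c : n.-tuple T => tnth c i) @^-1` A (lift ord0 i))); last first.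
    by apply/seteqP; split=> c /= Ac i; [move=> _|]; exact: Ac.
  apply: fin_bigcap_measurable => // i _; rewrite -[X in measurable X]setTI.
  exact: measurable_tnth.
rewrite big_ord_recl -IHn// -product_measure1E//.
rewrite /= /distribution /pushforward; congr (_ _).
apply/seteqP; split=> -[x c] /= Ac.
  by split; [exact: (Ac ord0)|move=> i; have := Ac (lift ord0 i); rewrite tnthS].
move=> i; case: Ac => /= Ax Ac.
by case: (unliftP ord0 i) => [j ->|->]; [rewrite tnthS; exact: Ac|].
Qed.

Definition symmetric_measure (R : realType)
    (mu : probability (measurableTypeR R) R) : Prop :=
  forall A : set (measurableTypeR R), measurable A ->
    mu A = mu [set - x | x in A].

Definition finite_variance (R : realType)
    (mu : probability (measurableTypeR R) R) : Prop :=
  ('V_mu[(@idfun R : measurableTypeR R -> R)] < +oo)%E.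

Definition F (R : realType) (mu : probability (measurableTypeR R) R) (t : R)
  : R := fine (mu `]-oo, t]%classic).

Definition dotb (R : realType) (n : nat) (c : n.-tuple R) (x : n.-tuple bool)
  : R := \sum_(i < n) tnth c i * (tnth x i)%:R.

(* max over X of <c, x>; the max is taken in the extended reals, where the
   empty maximum -oo is neutral. *)
Definition max_dotb (R : realType) (n : nat) (X : {set n.-tuple bool})
    (c : n.-tuple R) : R :=
  fine (\big[maxe/-oo%E]_(x in X) (dotb c x)%:E).

Definition Gamma (R : realType) (n : nat) (X : {set n.-tuple bool})
    (mu : probability (measurableTypeR R) R) : R :=
  fine 'E_(power_prob mu n)[max_dotb X].

Definition G (R : realType) (mu : probability (measurableTypeR R) R) (n : nat)
    (X : {set n.-tuple bool}) (tau : R) : R :=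
  ln #|X|%:R - tau * Gamma X mu.

Definition g (R : realType) (mu : probability (measurableTypeR R) R)
    (tau a : R) : R :=
  ln (1 + expR (- (tau * a))) -
  tau * \int[@lebesgue_measure R]_(t in `[a, +oo[) (1 - F mu t).

Definition hamming_sphere (k n : nat) : {set n.-tuple bool} :=
  [set x : n.-tuple bool | (\sum_(i < n) tnth x i)%N == k]%SET.

(* Main.v *)
Require Import Defs.
From mathcomp Require Import all_boot all_order all_algebra.
From mathcomp Require Import all_classical all_reals all_analysis.
From mathcomp Require Import measurable_realfun.
From mathcomp Require Import ring lra.
Set Implicit Arguments.
Unset Strict Implicit.
Unset Printing Implicit Defensive.
Import Order.TTheory GRing.Theory Num.Theory.
Import numFieldNormedType.Exports.
Local Open Scope classical_set_scope.
Local Open Scope ring_scope.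

(** Write h(a) = E (gamma - a)_+ for the mean excess of the distribution over
    the level a. By Tonelli, h(a) is the integral of 1 - F over [a, +oo), so
    g_tau(a) = ln (1 + e^(-tau a)) - tau h(a). Everything is driven by this
    form of g ([mean_excessE], [gE]).

    Upper bound ([card_le_expR_Gamma]). By induction on n,
    |X| <= exp (tau Gamma(X) + n s), where s = sup g. Split X according to its
    first coordinate into slices X_0 and X_1, with G_i = Gamma(X_i). The maximum
    over X is at least the maximum over X_0, and at least gamma_1 plus the
    maximum over X_1. Choosing between the two by testing whether gamma_1
    exceeds the constant level a = G_0 - G_1 is a choice independent of the
    other coordinates, and gives Gamma(X) >= G_0 + h(a) ([Gamma_slices]).
    On the other hand |X_0| + |X_1| is at most
    exp (tau G_0 + n s) (1 + e^(-tau a)) = exp (tau (G_0 + h(a)) + n s + g(a)),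
    and g(a) <= s. As a may be negative, this uses that g is even, which follows
    from the symmetry of the distribution: h(-a) = a + h(a) ([gN]). If one slice
    is empty, s >= 0 suffices, and s >= 0 because h vanishes at infinity
    ([sup_g_ge0]).

    Lower bound ([G_sphere_ge]). For every x with exactly k ones,
    <c, x> <= k a + sum_i (gamma_i - a)_+, hence
    Gamma(S(k, n)) <= k a + n h(a). With q = e^(-tau a) this makes
    G(S(k, n)) at least ln (C(n, k) q^k) - tau n h(a). The terms C(n, k) q^k,
    0 <= k <= n, add up to (1 + q)^n, so their largest one is at least
    (1 + q)^n / (n + 1), and for this k the sphere satisfies
    G(S(k, n)) >= n g(a) - ln (n + 1). For a = a_0 the two bounds squeeze
    G(S(k, n)) / n.

    Location of the optimal spheres. Comparing the largest term with its
    neighbours gives |k - n q / (1 + q)| <= 1 ([binomial_mode]), and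
    q / (1 + q) = 1 - F(a_0) is the first-order condition for g to be maximal at
    a_0. That condition is obtained without differentiating, from the tangent
    line of the convex function ln (1 + e^x) and a subgradient of the convex
    function h ([tail_at_maximizer]). *)

(** * Real-valued integrable functions *)

Lemma le_integrableR {d} {T : measurableType d} {R : realType}
    (P : {measure set T -> \bar R}) (f g : T -> R) :
  measurable_fun [set: T] f -> P.-integrable [set: T] (EFin \o g) ->
  (forall x, `|f x| <= g x) -> P.-integrable [set: T] (EFin \o f).
Proof.
move=> mf ig fg; apply: le_integrable ig => //; first exact/measurable_EFinP.
by move=> x _ /=; rewrite lee_fin (le_trans (fg x))// ler_norm.
Qed.

Section real_integrable.
Context {d} {T : measurableType d} {R : realType}.
Variable P : {measure set T -> \bar R}.
Implicit Types f g : T -> R.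

Lemma integrableRD f g : P.-integrable setT (EFin \o f) ->
  P.-integrable setT (EFin \o g) ->
  P.-integrable setT (EFin \o (fun x => f x + g x)).
Proof.
move=> If Ig; have := integrableD measurableT If Ig.
by apply: eq_integrable.
Qed.

Lemma integrableRB f g : P.-integrable setT (EFin \o f) ->
  P.-integrable setT (EFin \o g) ->
  P.-integrable setT (EFin \o (fun x => f x - g x)).
Proof.
move=> If Ig; have := integrableB measurableT If Ig.
by apply: eq_integrable.
Qed.

Lemma integrableRZl f (k : R) : P.-integrable setT (EFin \o f) ->
  P.-integrable setT (EFin \o (fun x => k * f x)).
Proof.
move=> If; have := integrableZl measurableT k If.
by apply: eq_integrable.
Qed.

Lemma integrableR_sum (I : finType) (f : I -> T -> R) :
  (forall i, P.-integrable setT (EFin \o f i)) ->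
  P.-integrable setT (EFin \o (fun x => \sum_i f i x)).
Proof.
move=> If; have := integrable_sum (P := xpredT) measurableT (index_enum I)
  (fun i _ => If i).
by apply: eq_integrable => // x _; rewrite /= sumEFin.
Qed.

Lemma integrable_normR f : P.-integrable setT (EFin \o f) ->
  P.-integrable setT (EFin \o (fun x => `|f x|)).
Proof. by move=> /integrable_abse; apply: eq_integrable. Qed.

Lemma Rintegral_sum (I : finType) (f : I -> T -> R) :
  (forall i, P.-integrable setT (EFin \o f i)) ->
  \int[P]_x (\sum_i f i x) = \sum_i \int[P]_x f i x.
Proof.
move=> If; rewrite /Rintegral.
under eq_integral do rewrite -sumEFin.
rewrite integral_sum// sum_fine//= => i _.
exact: (integrable_fin_num measurableT (If i)).
Qed.

End real_integrable.

(** * Mean excess over a level *)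

Definition excess (R : realType) (a x : R) : R := Num.max (x - a) 0.

Definition mean_excess (R : realType) (mu : probability (measurableTypeR R) R)
  (a : R) : R := \int[mu]_x excess a x.

Lemma excess_ge0 (R : realType) (a x : R) : 0 <= excess a x.
Proof. by rewrite /excess le_max lexx orbT. Qed.

(** Since x - a = (x - c) - (a - c), this is the inequality between the
    arithmetic and geometric means. *)
Lemma excess_le_square (R : realType) (a c x : R) : c < a ->
  excess a x <= (x - c) ^+ 2 / (4 * (a - c)).
Proof.
move=> ca; have ac : 0 < 4 * (a - c) by lra.
rewrite /excess ge_max divr_ge0 ?sqr_ge0 ?(ltW ac) ?andbT// ler_pdivlMr//.
by have := sqr_ge0 ((x - c) - 2 * (a - c)); nra.
Qed.

Lemma measurable_excess (R : realType) (a : R) :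
  measurable_fun [set: measurableTypeR R]
    (excess a : measurableTypeR R -> measurableTypeR R).
Proof. by apply: measurable_maxr => //; apply: measurable_funB. Qed.

Section moments.
Variables (R : realType) (mu : probability (measurableTypeR R) R).
Notation c0 := (fine 'E_mu[(@idfun R : measurableTypeR R -> R)]).

Lemma integrable_centered_square : finite_variance mu ->
  mu.-integrable setT (EFin \o (fun x : R => (x - c0) ^+ 2)).
Proof.
rewrite /finite_variance /variance covariance.unlock.
set c := fine _; rewrite expectation.unlock => fv.
apply/integrableP; split.
  by apply/measurable_EFinP; apply: measurable_funX; apply: measurable_funB.
apply: le_lt_trans fv.
rewrite le_eqVlt; apply/orP; left; apply/eqP; apply: eq_integral => x _.
by rewrite /= ger0_norm ?sqr_ge0// expr2.
Qed.

Lemma integrable_idfun : finite_variance mu ->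
  mu.-integrable setT (EFin \o (idfun : measurableTypeR R -> R)).
Proof.
move=> /integrable_centered_square; set c := c0 => i2.
have ic : mu.-integrable setT (EFin \o fun=> (1 + `|c|)).
  exact: finite_measure_integrable_cst.
apply: (@le_integrableR _ (measurableTypeR R) R mu idfun
  (fun x : R => (x - c) ^+ 2 + (1 + `|c|))) => //.
- exact: measurable_id.
- exact: integrableRD i2 ic.
move=> x /=.
have := ler_normD (x - c) c; rewrite subrK => /le_trans; apply.
rewrite addrA lerD2r -real_normK ?num_real//.
have := normr_ge0 (x - c); nra.
Qed.

Lemma integrable_excess (a : R) : finite_variance mu ->
  mu.-integrable setT (EFin \o excess a).
Proof.
move=> fv.
have ic : mu.-integrable setT (EFin \o fun=> `|a|).
  exact: finite_measure_integrable_cst.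
apply: (@le_integrableR _ (measurableTypeR R) R mu (excess a)
  (fun x : R => `|x| + `|a|)).
- exact: measurable_excess.
- by apply: integrableRD => //; exact: integrable_normR (integrable_idfun fv).
move=> x; rewrite ger0_norm ?excess_ge0// /excess ge_max addr_ge0 ?andbT//.
by rewrite (le_trans (ler_norm _))// ler_normB.
Qed.

Lemma mean_excess_ge0 (a : R) : 0 <= mean_excess mu a.
Proof. by apply: Rintegral_ge0 => x _; exact: excess_ge0. Qed.

(** The reason why a finite variance makes the mean excess vanish at infinity. *)
Lemma mean_excess_le_variance (a : R) : finite_variance mu -> c0 < a ->
  mean_excess mu a <= (\int[mu]_x (x - c0) ^+ 2) / (4 * (a - c0)).
Proof.
move=> fv; set c := c0 => ca.
rewrite -RintegralZr//; last exact: integrable_centered_square.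
apply: le_Rintegral => //; first exact: integrable_excess.
  have := integrableZr measurableT (4 * (a - c))^-1
    (integrable_centered_square fv).
  by apply: eq_integrable => // x _; rewrite /= EFinM.
move=> x _; exact: excess_le_square.
Qed.

End moments.

(** * Measure-preserving maps and symmetry *)

Section transfer.
Context {d d'} {T : measurableType d} {T' : measurableType d'} {R : realType}.
Variables (P : {measure set T -> \bar R}) (Q : {measure set T' -> \bar R}).
Variable phi : T -> T'.
Hypothesis mphi : measurable_fun [set: T] phi.
Hypothesis phiPQ : forall A, measurable A -> P (phi @^-1` A) = Q A.

Lemma integral_measure_preserving (f : T' -> \bar R) :
  measurable_fun [set: T'] f -> (forall y, (0 <= f y)%E) ->
  (\int[P]_x f (phi x) = \int[Q]_y f y)%E.
Proof.
move=> mf f0; transitivity (\int[pushforward P phi]_y f y)%E.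
  by rewrite (ge0_integral_pushforward mphi).
by apply: eq_measure_integral => A mA _; exact: phiPQ.
Qed.

Lemma integrable_measure_preserving (f : T' -> R) :
  Q.-integrable setT (EFin \o f) -> P.-integrable setT (EFin \o (f \o phi)).
Proof.
move=> /integrableP[mf foo]; apply/integrableP; split.
  exact: (measurableT_comp mf mphi).
have := @integral_measure_preserving (fun y => `|(f y)%:E|)%E.
move=> /= ->//; apply/measurable_EFinP; apply: measurableT_comp => //.
exact/measurable_EFinP.
Qed.

Lemma Rintegral_measure_preserving (f : T' -> R) :
  Q.-integrable setT (EFin \o f) ->
  \int[P]_x f (phi x) = \int[Q]_y f y.
Proof.
move=> If; have [mf _] := integrableP _ _ _ If.
have := integrable_measure_preserving If => IPf.
rewrite /Rintegral; congr fine.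
transitivity (\int[pushforward P phi]_y (f y)%:E)%E.
  by rewrite (integral_pushforward mphi mf).
by apply: eq_measure_integral => A mA _; exact: phiPQ.
Qed.

End transfer.

Lemma Rintegral_probability_cst d (T : measurableType d) (R : realType)
    (P : probability T R) (r : R) : \int[P]_x r = r.
Proof.
rewrite Rintegral_cst//; have /(congr1 fine)/= := probability_setT P.
rewrite -[Probability.sort P _]/((P : {measure set T -> \bar R}) _) => ->.
by rewrite mulr1.
Qed.

Section symmetric.
Context {R : realType}.
Variable mu : probability (measurableTypeR R) R.
Hypotheses (sym : symmetric_measure mu) (fv : finite_variance mu).

Lemma measure_preimage_opp (A : set (measurableTypeR R)) : measurable A ->
  mu ((fun x : R => - x) @^-1` A) = mu A.
Proof.
move=> mA; apply: etrans (esym (sym mA)); congr (mu _).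
apply/seteqP; split=> x /=; first by exists (- x) => //; rewrite opprK.
by case=> y Ay <-; rewrite opprK.
Qed.

Lemma integrable_opp (f : R -> R) :
  mu.-integrable setT (EFin \o (f : measurableTypeR R -> R)) ->
  mu.-integrable setT (EFin \o (fun x : measurableTypeR R => f (- x))).
Proof.
move=> If; apply: (integrable_measure_preserving _ measure_preimage_opp If).
exact: oppr_measurable.
Qed.

Lemma Rintegral_opp (f : R -> R) :
  mu.-integrable setT (EFin \o (f : measurableTypeR R -> R)) ->
  \int[mu]_x f (- x) = \int[mu]_x f x.
Proof.
move=> If; apply: (Rintegral_measure_preserving _ measure_preimage_opp If).
exact: oppr_measurable.
Qed.

Lemma mean0 : \int[mu]_x x = 0.
Proof.
have I := integrable_idfun fv.
have := Rintegral_opp I; rewrite /=.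
under eq_Rintegral do rewrite -mulN1r.
rewrite (RintegralZl _ _ I)//; lra.
Qed.

(** Integrate (x + a)_+ = (x + a) + (- x - a)_+, using that the distribution is
    centered and invariant under x |-> - x. *)
Lemma mean_excessN (a : R) : mean_excess mu (- a) = a + mean_excess mu a.
Proof.
have I := integrable_idfun fv.
have Ic : mu.-integrable setT (EFin \o fun=> a).
  exact: finite_measure_integrable_cst.
have -> : mean_excess mu a = \int[mu]_x excess a (- x).
  by rewrite Rintegral_opp//; exact: integrable_excess.
transitivity (\int[mu]_x ((x + a) + excess a (- x))).
  apply: eq_Rintegral => x _; rewrite /excess opprK.
  by have [h1|h1] := leP (x + a) 0; have [h2|h2] := leP (- x - a) 0 => //; lra.
rewrite RintegralD//; first last.
- exact/integrable_opp/integrable_excess.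
- exact: (integrableRD I Ic).
rewrite (RintegralD _ I Ic)//.
by rewrite mean0 add0r Rintegral_probability_cst.
Qed.

End symmetric.

(** * The mean excess as an integral of the tail *)

Section tails.
Context {R : realType}.
Variable mu : probability (measurableTypeR R) R.

Lemma tailE (t : R) : (1 - F mu t)%:E = mu `]t, +oo[%classic.
Proof.
have E : (mu `]-oo, t]%classic + mu `]t, +oo[%classic = 1)%E.
  rewrite -measureU//=; last by apply/eqP; exact: disjoint_rays.
  by rewrite itv_setU_setT; exact: (probability_setT mu).
have f1 : mu `]-oo, t]%classic \is a fin_num by exact: fin_num_measure.
have f2 : mu `]t, +oo[%classic \is a fin_num by exact: fin_num_measure.
rewrite /F -(fineK f2); congr EFin; move/(congr1 fine): E.
by rewrite fineD//= => <-; rewrite addrC addKr.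
Qed.

(** Layer cake: (x - a)_+ is the length of [a, x), so exchanging the integrals
    over x and t leaves the measure of the x with x > t. *)
Lemma mean_excessE (a : R) :
  \int[@lebesgue_measure R]_(t in `[a, +oo[) (1 - F mu t) = mean_excess mu a.
Proof.
rewrite /Rintegral /mean_excess; congr fine.
pose K (p : measurableTypeR R * measurableTypeR R) :=
  ((\1_`[a, p.1[ p.2)%:E : \bar R)%E.
have mK : measurable_fun setT K.
  apply/measurable_EFinP/measurable_indic => /=.
  pose above (p : measurableTypeR R * measurableTypeR R) := a <= p.2.
  pose below (p : measurableTypeR R * measurableTypeR R) := p.2 < p.1.
  rewrite [X in measurable X](_ : _ =
      above @^-1` [set true] `&` below @^-1` [set true]); last first.
    by apply/seteqP; split => p; rewrite in_itv/= => /andP.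
  apply: measurableI.
  - have : measurable_fun setT above by exact: measurable_fun_ler.
    by move=> /(_ measurableT [set true]); rewrite setTI; exact.
  - have : measurable_fun setT below by exact: measurable_fun_ltr.
    by move=> /(_ measurableT [set true]); rewrite setTI; exact.
have K0 p : (0 <= K p)%E by rewrite lee_fin.
transitivity (\int[@lebesgue_measure R]_t \int[mu]_x K (x, t))%E.
  rewrite integral_mkcond; apply: eq_integral => t _.
  have E : [set x : measurableTypeR R | t \in `[a, x[] =
           if a <= t then `]t, +oo[%classic else set0.
    case: ifPn => at_; apply/seteqP; split=> x //=.
    - by rewrite !in_itv/= at_ andbT.
    - by rewrite !in_itv/= at_ andbT.
    - by rewrite in_itv/= (negbTE at_).
  rewrite patchE mem_setE in_itv/= andbT.
  transitivity (mu [set x : measurableTypeR R | t \in `[a, x[]).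
    rewrite E; case: ifPn => _; first by rewrite tailE.
    by rewrite measure0.
  rewrite -[X in mu X]setIT -integral_indic//; last first.
    by rewrite E; case: ifPn.
rewrite -(fubini_tonelli K mK K0).
apply: eq_integral => x _; rewrite /K/= integral_indic//= setIT.
rewrite lebesgue_measure_itv/=.
rewrite lte_fin /excess.
have [ax|xa] := ltP a x.
  by rewrite EFinN -EFinB max_l// subr_ge0 ltW.
by rewrite max_r// subr_le0.
Qed.
End tails.

(** * The function g *)

Section g_properties.
Context {R : realType}.
Variables (mu : probability (measurableTypeR R) R) (tau : R).
Hypotheses (sym : symmetric_measure mu) (fv : finite_variance mu).
Hypothesis tau0 : 0 < tau.
Notation sup_g := (sup [set g mu tau a | a in [set a | 0 <= a]]).

Lemma gE (a : R) :
  g mu tau a = ln (1 + expR (- (tau * a))) - tau * mean_excess mu a.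
Proof. by rewrite /g mean_excessE. Qed.

Lemma ln1pexp_gt0 (x : R) : 0 < 1 + expR x.
Proof. by rewrite addr_gt0// expR_gt0. Qed.

Lemma gN (a : R) : g mu tau (- a) = g mu tau a.
Proof.
rewrite !gE mean_excessN// mulrN opprK.
have -> : 1 + expR (tau * a) = expR (tau * a) * (1 + expR (- (tau * a))).
  by rewrite mulrDr mulr1 expRxMexpNx_1 addrC.
rewrite lnM ?posrE ?expR_gt0 ?ln1pexp_gt0// expRK; lra.
Qed.

Lemma g_le_ln2 (a : R) : 0 <= a -> g mu tau a <= ln 2.
Proof.
move=> a0; rewrite gE lerBlDr (@le_trans _ _ (ln 2))//.
  rewrite ler_ln ?posrE ?ln1pexp_gt0// (_ : 2 = 1 + 1)// lerD2l.
  by rewrite expR_le1 oppr_le0 mulr_ge0// ltW.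
by rewrite lerDl mulr_ge0 ?mean_excess_ge0// ltW.
Qed.

Lemma g_le_sup (a : R) : g mu tau a <= sup_g.
Proof.
wlog a0 : a / 0 <= a => [H|].
  by have [/H//|/ltW a0] := leP 0 a; rewrite -gN; apply: H; rewrite oppr_ge0.
apply: ub_le_sup; last by exists a.
by exists (ln 2) => _ [b /= b0 <-]; exact: g_le_ln2.
Qed.

(** The logarithm in g is positive, and the mean excess tends to 0, so a
    negative supremum would be exceeded far out. *)
Lemma sup_g_ge0 : 0 <= sup_g.
Proof.
rewrite leNgt; apply/negP => s0.
set c := fine 'E_mu[(@idfun R : measurableTypeR R -> R)].
set v := \int[mu]_x (x - c) ^+ 2.
have v0 : 0 <= v by apply: Rintegral_ge0 => x _; exact: sqr_ge0.
pose e := - sup_g.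
have e0 : 0 < e by rewrite /e oppr_gt0.
(* a is chosen such that the variance bound gives tau * mean_excess <= e *)
pose a := c + 1 + tau * v / e.
have q0 : 0 <= tau * v / e by rewrite divr_ge0 ?mulr_ge0// ltW.
have ca : c < a by rewrite /a; lra.
have := mean_excess_le_variance fv ca; rewrite -/c -/v => hv.
have := g_le_sup a; rewrite gE.
have : 0 < ln (1 + expR (- (tau * a))) by rewrite ln_gt0// ltrDl expR_gt0.
have : tau * mean_excess mu a <= e.
  apply: le_trans (ler_wpM2l (ltW tau0) hv) _.
  rewrite mulrA ler_pdivrMr; last by lra.
  have -> : tau * v = e * (tau * v / e) by field; rewrite gt_eqF.
  rewrite ler_pM2l// /a; lra.
rewrite /e; lra.
Qed.

(** Convexity of the mean excess, with slope F b - 1 at b: pointwise,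
    (x - a)_+ >= (x - b)_+ - (a - b) whenever x > b. *)
Lemma mean_excess_subgradient (a b : R) :
  mean_excess mu b - (a - b) * (1 - F mu b) <= mean_excess mu a.
Proof.
have Ib : mu.-integrable setT (EFin \o (\1_`]b, +oo[ : measurableTypeR R -> R)).
  by apply: integrable_indic => //; rewrite -ge0_fin_numE// fin_num_measure.
have -> : 1 - F mu b = \int[mu]_x (\1_`]b, +oo[ x).
  by apply: EFin_inj; rewrite tailE /Rintegral integral_indic// setIT fineK//
    fin_num_measure.
have Ieb := integrable_excess b fv.
rewrite -(RintegralZl _ _ Ib)// -(RintegralB _ Ieb (integrableRZl _ Ib))//.
apply: le_Rintegral => //; first exact: (integrableRB Ieb (integrableRZl _ Ib)).
  exact: integrable_excess.
move=> x _; rewrite /excess indicE mem_setE in_itv/= andbT.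
case: (ltP b x) => bx; rewrite ?mulr1 ?mulr0 ?subr0.
  by rewrite max_l ?le_max; [apply/orP; left|]; lra.
by rewrite max_r ?le_max ?lexx ?orbT//; lra.
Qed.

End g_properties.

(** * Product measures and independent coordinates *)

Section product.
Context {d1 d2} {T1 : measurableType d1} {T2 : measurableType d2}.
Context {R : realType}.
Variables (P1 : probability T1 R) (P2 : probability T2 R).

Lemma product_preimage_fst (A : set T1) : measurable A ->
  (P1 \x P2)%E (fst @^-1` A) = P1 A.
Proof.
move=> mA; have -> : fst @^-1` A = A `*` [set: T2].
  by apply/seteqP; split=> -[x y] //= [].
by rewrite product_measure1E// [X in (_ * X)%E]probability_setT mule1.
Qed.

Lemma product_preimage_snd (A : set T2) : measurable A ->
  (P1 \x P2)%E (snd @^-1` A) = P2 A.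
Proof.
move=> mA; have -> : snd @^-1` A = [set: T1] `*` A.
  by apply/seteqP; split=> -[x y] //= [].
by rewrite product_measure1E// [X in (X * _)%E]probability_setT mul1e.
Qed.

Variables (f : T1 -> R) (h : T2 -> R).
Hypotheses (If : P1.-integrable setT (EFin \o f))
  (Ih : P2.-integrable setT (EFin \o h)).

Lemma integrable_prodM :
  (P1 \x P2)%E.-integrable setT (EFin \o (fun p => f p.1 * h p.2)).
Proof.
have [/measurable_EFinP mf foo] := integrableP _ _ _ If.
have [/measurable_EFinP mh hoo] := integrableP _ _ _ Ih.
apply/integrable12ltyP.
  apply/measurable_EFinP/measurable_funM.
    exact: (measurableT_comp mf).
  exact: (measurableT_comp mh).
under eq_integral => x _.
  under eq_integral => y _ do rewrite /= normrM EFinM.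
  rewrite ge0_integralZl//; first over.
  by apply/measurable_EFinP; exact: measurableT_comp.
rewrite ge0_integralZr//; last first.
- exact: integral_ge0.
- by apply/measurable_EFinP; exact: measurableT_comp.
apply: lte_mul_pinfty => //; first exact: integral_ge0.
by rewrite ge0_fin_numE//; exact: integral_ge0.
Qed.

Lemma Rintegral_prodM : \int[(P1 \x P2)%E]_p (f p.1 * h p.2) =
  (\int[P1]_x f x) * (\int[P2]_y h y).
Proof.
have I := integrable_prodM.
rewrite /Rintegral -(integral12_prod_meas1 I).
rewrite -fineM; [|exact: integrable_fin_num..].
congr fine; rewrite /fubini_F/=.
under eq_integral => x _.
  under eq_integral => y _ do rewrite EFinM.
  rewrite (integralZl _ Ih)//; over.
rewrite -[in LHS](fineK (integrable_fin_num measurableT Ih)).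
by rewrite (integralZr _ If)//= fineK// (integrable_fin_num measurableT Ih).
Qed.

End product.

Lemma power_prob_coord (R : realType) d (T : measurableType d)
    (P : probability T R) (n : nat) (i : 'I_n) (A : set T) : measurable A ->
  power_prob P n ((fun c => tnth c i) @^-1` A) = P A.
Proof.
move=> mA; pose B (j : 'I_n) := if j == i then A else setT.
have mB j : measurable (B j) by rewrite /B; case: ifP.
have -> : (fun c : n.-tuple T => tnth c i) @^-1` A =
    [set c | forall j, B j (tnth c j)].
  apply/seteqP; split=> c /=; last by move=> /(_ i); rewrite /B eqxx.
  by move=> Ac j; rewrite /B; case: eqP => [->|].
rewrite power_prob_box// (bigD1 i)//= /B eqxx big1 ?mule1// => j /negbTE ->.
exact: probability_setT.
Qed.

(** * The maximum of a random linear form *)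

Section max_dotb.
Context {R : realType} {n : nat}.
Implicit Types (X : {set n.-tuple bool}) (c : n.-tuple R).

Lemma max_dotb_attained X c : X != finset.set0 ->
  exists2 x, x \in X & max_dotb X c = dotb c x /\
    forall y, y \in X -> dotb c y <= dotb c x.
Proof.
move=> /set0Pn[x0 Xx0].
case: (@Order.TotalTheory.arg_maxP _ _ _ x0 (mem X) (dotb c) Xx0) => x Xx xmax.
exists x => //; split=> //; rewrite /max_dotb.
suff -> : (\big[maxe/-oo%E]_(x in X) (dotb c x)%:E = (dotb c x)%:E)%E by [].
apply/eqP; rewrite eq_le; apply/andP; split.
  apply/bigmax_leP; split; first exact: leNye.
  by move=> y Xy; rewrite lee_fin; exact: xmax.
exact: (le_bigmax_cond _ (fun x => (dotb c x)%:E)).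
Qed.

Lemma le_max_dotb X c x : x \in X -> dotb c x <= max_dotb X c.
Proof.
move=> Xx; have X0 : X != finset.set0 by apply/set0Pn; exists x.
by have [y Xy [-> ymax]] := max_dotb_attained c X0; exact: ymax.
Qed.

Lemma dotb_norm_le c (x : n.-tuple bool) : `|dotb c x| <= \sum_i `|tnth c i|.
Proof.
apply: le_trans (ler_norm_sum _ _ _) _; apply: ler_sum => i _.
by case: (tnth x i); rewrite ?mulr1// mulr0 normr0.
Qed.

Lemma measurable_dotb (x : n.-tuple bool) :
  measurable_fun [set: n.-tuple (measurableTypeR R)]
    (fun c : n.-tuple R => dotb c x).
Proof.
apply: measurable_sum => i; apply: measurable_funM => //.
exact: measurable_tnth.
Qed.

Lemma measurable_max_dotb X :
  measurable_fun [set: n.-tuple (measurableTypeR R)] (@max_dotb R n X).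
Proof.
apply: (measurableT_comp (@fine_measurable R setT measurableT)).
rewrite [X in measurable_fun _ X](_ : _ = fun c : n.-tuple R =>
  \big[maxe/-oo%E]_(x <- enum X) (dotb c x)%:E)%E; last first.
  by apply/funext => c; rewrite big_enum.
elim: (enum X) => [|x s IH].
  rewrite [X in measurable_fun _ X](_ : _ = cst -oo%E)//.
  by apply/funext => c; rewrite big_nil.
rewrite [X in measurable_fun _ X](_ : _ =
   (fun c : n.-tuple R => (dotb c x)%:E) \max
   (fun c : n.-tuple R => \big[maxe/-oo%E]_(x <- s) (dotb c x)%:E))%E; last first.
  by apply/funext => c; rewrite big_cons.
apply: measurable_maxe => //.
by apply/measurable_EFinP; exact: measurable_dotb.
Qed.

End max_dotb.

Section Gamma.
Context {R : realType}.
Variable mu : probability (measurableTypeR R) R.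
Hypothesis fv : finite_variance mu.

Lemma GammaE n (X : {set n.-tuple bool}) :
  Gamma X mu = \int[power_prob mu n]_c max_dotb X c.
Proof. by rewrite /Gamma expectation.unlock. Qed.

Lemma integrable_coord n (i : 'I_n) (f : R -> R) :
  mu.-integrable setT (EFin \o (f : measurableTypeR R -> R)) ->
  (power_prob mu n).-integrable setT
    (EFin \o (fun c : n.-tuple (measurableTypeR R) => f (tnth c i))).
Proof.
move=> If; apply: (integrable_measure_preserving _ _ If).
  exact: measurable_tnth.
exact: power_prob_coord.
Qed.

Lemma Rintegral_coord n (i : 'I_n) (f : R -> R) :
  mu.-integrable setT (EFin \o (f : measurableTypeR R -> R)) ->
  \int[power_prob mu n]_c f (tnth c i) = \int[mu]_x f x.
Proof.
move=> If; apply: (Rintegral_measure_preserving _ _ If).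
  exact: measurable_tnth.
exact: power_prob_coord.
Qed.

Lemma integrable_max_dotb n (X : {set n.-tuple bool}) : X != finset.set0 ->
  (power_prob mu n).-integrable setT
    (EFin \o (max_dotb X : n.-tuple (measurableTypeR R) -> R)).
Proof.
move=> X0; apply: (@le_integrableR _ _ R (power_prob mu n) (max_dotb X)
  (fun c => \sum_(i < n) `|tnth c i|)).
- exact: measurable_max_dotb.
- apply: integrableR_sum => i; apply: (@integrable_coord n i (fun x => `|x|)).
  exact: (integrable_normR (integrable_idfun fv)).
- by move=> c; have [x _ [-> _]] := max_dotb_attained c X0; exact: dotb_norm_le.
Qed.

End Gamma.

(** * Slicing along the first coordinate *)

Section slices.
Context {R : realType} {n : nat}.
Implicit Types (X : {set n.+1.-tuple bool}).

Definition slice (b : bool) X : {set n.-tuple bool} :=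
  [set x : n.-tuple bool | [tuple of b :: x] \in X]%SET.

Lemma card_slices X : #|X| = (#|slice false X| + #|slice true X|)%N.
Proof.
pose T b (x : n.-tuple bool) : n.+1.-tuple bool := [tuple of b :: x].
have Tinj b : injective (T b).
  by move=> x y /(congr1 val)[] xy; exact: val_inj.
have E : X = (T false @: slice false X :|: T true @: slice true X)%SET.
  apply/setP => x; rewrite !inE; apply/idP/orP.
    case/tupleP: x => -[] x Xx; [right|left]; apply/imsetP; exists x => //;
    by rewrite inE.
  by case=> /imsetP[y]; rewrite inE => Xy ->.
rewrite {1}E cardsU (_ : _ :&: _ = finset.set0)%SET.
  by rewrite cards0 subn0 !card_imset.
apply/setP => x; rewrite !inE; apply/negbTE/andP => -[].
by move=> /imsetP[y _ ->] /imsetP[z _] /(congr1 val).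
Qed.

Lemma dotb_cons (y : R) (c : n.-tuple R) b (x : n.-tuple bool) :
  dotb [tuple of y :: c] [tuple of b :: x] = y * b%:R + dotb c x.
Proof.
rewrite /dotb big_ord_recl !tnth0; congr (_ + _).
by apply: eq_bigr => i _; rewrite !tnthS.
Qed.

Lemma max_dotb_slice X b (p : R * n.-tuple R) : slice b X != finset.set0 ->
  max_dotb (slice b X) p.2 + p.1 * b%:R <= max_dotb X [tuple of p.1 :: p.2].
Proof.
move=> /max_dotb_attained-/(_ _ p.2)[x]; rewrite inE => Xx [-> _].
by rewrite addrC -dotb_cons; exact: le_max_dotb.
Qed.

End slices.

(** The left-hand side is m0 if y <= a and m1 + y otherwise. Written in this
    form, its last term has mean 0 when y is independent of (m0, m1) and
    a = E m0 - E m1. *)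
Lemma threshold_le_max (R : realType) (a y m m0 m1 : R) :
  m0 <= m -> m1 + y <= m ->
  m0 + excess a y + (a < y)%R%:R * (m1 - m0 + a) <= m.
Proof.
move=> m0m m1m; rewrite /excess; case: (ltP a y) => ay; rewrite ?mul1r ?mul0r.
  by rewrite max_l ?subr_ge0 ?(ltW ay)//; lra.
by rewrite max_r ?subr_le0//; lra.
Qed.

Section Gamma_slices.
Context {R : realType}.
Variable mu : probability (measurableTypeR R) R.
Hypotheses (sym : symmetric_measure mu) (fv : finite_variance mu).
Variables (n : nat) (X : {set n.+1.-tuple bool}).
Notation mun := (power_prob mu n).
Notation TR := (measurableTypeR R).

Lemma Gamma_cons : X != finset.set0 ->
  (mu \x mun)%E.-integrable setT
    (EFin \o (fun p : TR * n.-tuple TR => max_dotb X [tuple of p.1 :: p.2])) /\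
  Gamma X mu = \int[(mu \x mun)%E]_p max_dotb X [tuple of p.1 :: p.2].
Proof.
move=> X0; have I := integrable_max_dotb fv X0.
have mc := @measurable_cons_pair _ TR n.
split; first by apply: (integrable_measure_preserving mc _ I).
by rewrite GammaE; apply/esym; apply: (Rintegral_measure_preserving mc _ I).
Qed.

Lemma integrable_fst (f : R -> R) :
  mu.-integrable setT (EFin \o (f : TR -> R)) ->
  (mu \x mun)%E.-integrable setT (EFin \o (fun p : TR * n.-tuple TR => f p.1)).
Proof.
move=> If; apply: (integrable_measure_preserving _ _ If).
  exact: measurable_fst.
exact: product_preimage_fst.
Qed.

Lemma Rintegral_fst (f : R -> R) :
  mu.-integrable setT (EFin \o (f : TR -> R)) ->
  \int[(mu \x mun)%E]_p f p.1 = \int[mu]_x f x.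
Proof.
move=> If; apply: (Rintegral_measure_preserving _ _ If).
  exact: measurable_fst.
exact: product_preimage_fst.
Qed.

Lemma integrable_snd (f : n.-tuple R -> R) :
  mun.-integrable setT (EFin \o (f : n.-tuple TR -> R)) ->
  (mu \x mun)%E.-integrable setT (EFin \o (fun p : TR * n.-tuple TR => f p.2)).
Proof.
move=> If; apply: (integrable_measure_preserving _ _ If).
  exact: measurable_snd.
exact: product_preimage_snd.
Qed.

Lemma Rintegral_snd (f : n.-tuple R -> R) :
  mun.-integrable setT (EFin \o (f : n.-tuple TR -> R)) ->
  \int[(mu \x mun)%E]_p f p.2 = \int[mun]_x f x.
Proof.
move=> If; apply: (Rintegral_measure_preserving _ _ If).
  exact: measurable_snd.
exact: product_preimage_snd.
Qed.

Lemma slice_neq0 b : slice b X != finset.set0 -> X != finset.set0.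
Proof.
by move=> /set0Pn[x]; rewrite inE => Xx; apply/set0Pn; eexists; exact: Xx.
Qed.

(** The first coordinate has mean 0, so prescribing it costs nothing on
    average. *)
Lemma Gamma_slice b : slice b X != finset.set0 ->
  Gamma (slice b X) mu <= Gamma X mu.
Proof.
move=> S0; have [IX ->] := Gamma_cons (slice_neq0 S0).
have IS := integrable_max_dotb fv S0.
have Iid := integrable_fst (integrable_idfun fv).
have IS' := integrable_snd IS.
have Ib := integrableRZl b%:R Iid.
rewrite GammaE -(Rintegral_snd IS).
rewrite -[leLHS]addr0 -[X in _ + X](mulr0 (b%:R : R)) -(mean0 sym fv).
rewrite -(Rintegral_fst (integrable_idfun fv)).
rewrite -(RintegralZl _ _ Iid)// -(RintegralD _ IS' Ib)//.
apply: le_Rintegral => //; first exact: (integrableRD IS' Ib).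
by move=> p _; rewrite mulrC; exact: max_dotb_slice.
Qed.

(** The recursive step of the upper bound: the maximum over X is at least the
    strategy that picks the slice by comparing the first coordinate with the
    difference of the two expected maxima. *)
Lemma Gamma_slices :
  slice false X != finset.set0 -> slice true X != finset.set0 ->
  Gamma (slice false X) mu +
    mean_excess mu (Gamma (slice false X) mu - Gamma (slice true X) mu) <=
  Gamma X mu.
Proof.
move=> S0 S1; have [IX ->] := Gamma_cons (slice_neq0 S0).
set G0 := Gamma _ mu; set G1 := Gamma (slice true X) mu; set a := G0 - G1.
have I0 := integrable_max_dotb fv S0; have I1 := integrable_max_dotb fv S1.
have Ie := integrable_excess a fv.
have Ia : mu.-integrable setT (EFin \o (\1_`]a, +oo[ : TR -> R)).
  by apply: integrable_indic => //; rewrite -ge0_fin_numE// fin_num_measure.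
have Ic : mun.-integrable setT (EFin \o fun=> a).
  exact: finite_measure_integrable_cst.
have Id := integrableRD (integrableRB I1 I0) Ic.
have Id0 : \int[mun]_c
    (max_dotb (slice true X) c - max_dotb (slice false X) c + a) = 0.
  rewrite (RintegralD _ (integrableRB I1 I0) Ic)// (RintegralB _ I1 I0)//.
  rewrite Rintegral_probability_cst -!GammaE -/G0 -/G1 /a; ring.
have Ip := integrable_prodM Ia Id.
have Ie' := integrable_fst Ie; have I0' := integrable_snd I0.
have -> : G0 + mean_excess mu a = \int[(mu \x mun)%E]_p
   (max_dotb (slice false X) p.2 + excess a p.1 +
    \1_`]a, +oo[ p.1 * (max_dotb (slice true X) p.2 -
                          max_dotb (slice false X) p.2 + a)).
  rewrite (RintegralD _ (integrableRD I0' Ie') Ip)// (RintegralD _ I0' Ie')//.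
  rewrite (Rintegral_prodM Ia Id) Id0 mulr0 addr0.
  by rewrite (Rintegral_snd I0) (Rintegral_fst Ie) -GammaE.
apply: le_Rintegral => //.
  exact: (integrableRD (integrableRD I0' Ie') Ip).
move=> p _; rewrite indicE mem_setE in_itv/= andbT.
have := max_dotb_slice p S1; rewrite mulr1; apply: threshold_le_max.
by have := max_dotb_slice p S0; rewrite mulr0 addr0.
Qed.

End Gamma_slices.

(** * Upper bound for arbitrary sets *)

Section upper_bound.
Context {R : realType}.
Variables (mu : probability (measurableTypeR R) R) (tau : R).
Hypotheses (sym : symmetric_measure mu) (fv : finite_variance mu).
Hypothesis tau0 : 0 < tau.
Variable s : R.
Hypotheses (s0 : 0 <= s) (gs : forall a, g mu tau a <= s).

Lemma card_le_expR_Gamma n (X : {set n.-tuple bool}) : X != finset.set0 ->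
  #|X|%:R <= expR (tau * Gamma X mu + n%:R * s).
Proof.
elim: n X => [|n IH] X X0.
  have G0 : Gamma X mu = 0.
    rewrite GammaE -[RHS](Rintegral_probability_cst (power_prob mu 0)).
    apply: eq_Rintegral => c _.
    by have [x _ [-> _]] := max_dotb_attained c X0; rewrite /dotb big_ord0.
  rewrite G0 mulr0 mul0r addr0 expR0 -[1]/(1%:R) ler_nat.
  by rewrite (leq_trans (max_card _))// card_tuple expn0.
have step b : slice b X != finset.set0 ->
    #|slice b X|%:R <= expR (tau * Gamma X mu + n.+1%:R * s).
  move=> Sb; apply: le_trans (IH _ Sb) _; rewrite ler_expR.
  rewrite lerD ?ler_pM2l ?Gamma_slice// ler_wpM2r// ler_nat//.
rewrite card_slices natrD.
have [S0|S0] := eqVneq (slice false X) finset.set0.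
  have [S1|S1] := eqVneq (slice true X) finset.set0.
    by rewrite S0 S1 !cards0 addr0 expR_ge0.
  by rewrite S0 cards0 add0r step.
have [S1|S1] := eqVneq (slice true X) finset.set0.
  by rewrite S1 cards0 addr0 step.
have GS := Gamma_slices fv S0 S1.
set G0 := Gamma (slice false X) mu in GS *.
set G1 := Gamma (slice true X) mu in GS *.
pose a := G0 - G1; rewrite -/a in GS.
apply: le_trans (lerD (IH _ S0) (IH _ S1)) _; rewrite -/G0 -/G1.
have -> : tau * G1 + n%:R * s = tau * G0 + n%:R * s + - (tau * a).
  by rewrite /a; ring.
rewrite [expR (_ + - _)]expRD -[X in X + _]mulr1 -mulrDr.
(* 1 + e^(- tau a) becomes the exponential of g(a) + tau * mean_excess a *)
rewrite -(@lnK _ (1 + _)) ?posrE ?ln1pexp_gt0// -expRD ler_expR.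
have := gs a; rewrite gE => ga.
have := ler_wpM2l (ltW tau0) GS; rewrite mulrDr -natr1; lra.
Qed.

Lemma G_le n (X : {set n.-tuple bool}) : X != finset.set0 ->
  G mu X tau <= n%:R * s.
Proof.
move=> X0; rewrite /G lerBlDl -[leRHS]expRK ler_ln ?posrE ?expR_gt0//.
  exact: card_le_expR_Gamma.
by rewrite ltr0n card_gt0.
Qed.

End upper_bound.

(** * Hamming spheres *)

Section spheres.
Context {R : realType}.

(** Points of the sphere are the indicator vectors of the k-element subsets. *)
Lemma card_sphere k n : #|hamming_sphere k n| = 'C(n, k).
Proof.
rewrite -[n in RHS]card_ord -card_draws.
pose T (A : {set 'I_n}) : n.-tuple bool := [tuple i \in A | i < n].
have Tinj : injective T.
  move=> A B AB; apply/setP => i.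
  by have := congr1 (fun t => tnth t i) AB; rewrite !tnth_mktuple.
rewrite -(card_imset _ Tinj); apply: eq_card => x; apply/idP/imsetP.
  rewrite inE => /eqP xk; exists [set i | tnth x i]%SET.
    rewrite inE -xk -sum1dep_card big_mkcond/=; apply/eqP/eq_bigr => i _.
    by case: (tnth x i).
  by apply: eq_from_tnth => i; rewrite tnth_mktuple inE.
case=> A; rewrite inE => /eqP <- ->.
rewrite inE -sum1_card [X in _ == X]big_mkcond/=.
by apply/eqP/eq_bigr => i _; rewrite tnth_mktuple; case: (i \in A).
Qed.

Lemma sphere_neq0 k n : (k <= n)%N -> hamming_sphere k n != finset.set0.
Proof.
by move=> kn; rewrite -card_gt0 card_sphere bin_gt0.
Qed.

Variables (mu : probability (measurableTypeR R) R).
Hypothesis fv : finite_variance mu.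

(** Each of the k selected coordinates is at most a plus its excess over a; the
    remaining coordinates only contribute nonnegative excesses. *)
Lemma dotb_le_excess n k (a : R) (c : n.-tuple R) x :
  x \in hamming_sphere k n ->
  dotb c x <= k%:R * a + \sum_(i < n) excess a (tnth c i).
Proof.
rewrite inE => /eqP <-; rewrite natr_sum mulr_suml -big_split/=.
apply: ler_sum => i _; rewrite /excess.
case: (tnth x i); rewrite ?mulr1 ?mul1r ?mulr0 ?mul0r ?add0r ?le_max
  ?lexx ?orbT//.
by rewrite -lerBlDl le_max lexx.
Qed.

Lemma Gamma_sphere_le n k (a : R) : (k <= n)%N ->
  Gamma (hamming_sphere k n) mu <= k%:R * a + n%:R * mean_excess mu a.
Proof.
move=> kn; have S0 := sphere_neq0 kn.
have Ie (i : 'I_n) := integrable_coord i (integrable_excess a fv).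
have Ic : (power_prob mu n).-integrable setT (EFin \o fun=> k%:R * a).
  exact: finite_measure_integrable_cst.
have -> : k%:R * a + n%:R * mean_excess mu a =
    \int[power_prob mu n]_c (k%:R * a + \sum_(i < n) excess a (tnth c i)).
  rewrite (RintegralD _ Ic (integrableR_sum Ie))// Rintegral_probability_cst.
  rewrite (Rintegral_sum Ie); congr (_ + _).
  under eq_bigr do rewrite (Rintegral_coord _ (integrable_excess a fv)).
  by rewrite sumr_const card_ord mulr_natl.
rewrite GammaE; apply: le_Rintegral => //.
- exact: integrable_max_dotb.
- exact: (integrableRD Ic (integrableR_sum Ie)).
move=> c _; have [x Sx [-> _]] := max_dotb_attained c S0.
exact: dotb_le_excess.
Qed.

End spheres.

(** * The largest term of the binomial expansion *)

Section binomial_mode.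
Context {R : realType}.
Variables (q : R).
Hypothesis q0 : 0 < q.

Lemma binomial_weight_succ n k : (k <= n)%N ->
  k.+1%:R * ('C(n, k.+1)%:R * q ^+ k.+1) =
  (n%:R - k%:R) * q * ('C(n, k)%:R * q ^+ k).
Proof.
move=> kn; rewrite mulrA -natrM mul_bin_left natrM natrB// exprS; ring.
Qed.

(** The largest of the n + 1 terms is at least their average. It is not smaller
    than its two neighbours, and the ratio of consecutive terms
    ([binomial_weight_succ]) turns these comparisons into
    n q - 1 <= k (1 + q) <= (n + 1) q. *)
Lemma binomial_mode n : exists k, [/\ (k <= n)%N,
  (1 + q) ^+ n <= n.+1%:R * ('C(n, k)%:R * q ^+ k) &
  `|k%:R - q / (1 + q) * n%:R| <= 1].
Proof.
pose w k : R := 'C(n, k)%:R * q ^+ k.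
have w_gt0 k : (k <= n)%N -> 0 < w k.
  by move=> kn; rewrite mulr_gt0 ?exprn_gt0// ltr0n bin_gt0.
case: (@Order.TotalTheory.arg_maxP _ _ 'I_n.+1 ord0 xpredT w isT) => k _ kmax.
have kn : (k <= n)%N by rewrite -ltnS.
have max j : (j <= n)%N -> w j <= w k.
  by rewrite -ltnS => jn; exact: (kmax (Ordinal jn)).
exists k; split => //.
  rewrite exprDn mulr_natl -[X in _ *+ X]card_ord -sumr_const.
  by apply: ler_sum => i _; rewrite expr1n mul1r -mulr_natl; exact: kmax.
have q1 : 0 < 1 + q by rewrite addr_gt0.
have lo : n%:R * q - 1 <= k%:R * (1 + q).
  have [nk|kn'] := leqP n k.
    have -> : k%:R = n%:R :> R by congr _%:R; apply/eqP; rewrite eqn_leq kn nk.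
    by have : 0 <= n%:R :> R by []; lra.
  have : (n%:R - k%:R) * q * w k <= k.+1%:R * w k.
    by rewrite -binomial_weight_succ// ler_pM2l ?ltr0n// max.
  rewrite ler_pM2r ?w_gt0// -natr1; lra.
have hi : k%:R * (1 + q) <= n%:R * q + q.
  case: (nat_of_ord k) kn max => [|j] jn max.
    by rewrite mul0r addr_ge0 ?mulr_ge0 ?ler0n// ltW.
  have : j.+1%:R * w j.+1 <= (n%:R - j%:R) * q * w j.+1.
    rewrite binomial_weight_succ ?(ltnW jn)// ler_wpM2l ?max ?(ltnW jn)//.
    by rewrite mulr_ge0 ?(ltW q0)// subr_ge0 ler_nat ltnW.
  rewrite ler_pM2r ?w_gt0// -!natr1; lra.
have -> : q / (1 + q) * n%:R = n%:R * q / (1 + q) by ring.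
rewrite ler_norml; apply/andP; split.
  rewrite lerBrDr -(ler_pM2r q1) mulrDl divfK ?gt_eqF//.
  have := q0; lra.
by rewrite lerBlDr -(ler_pM2r q1) mulrDl divfK ?gt_eqF//; lra.
Qed.

End binomial_mode.

(** * Lower bound for spheres and convergence *)

Section lower_bound.
Context {R : realType}.
Variables (mu : probability (measurableTypeR R) R) (tau : R).
Hypotheses (fv : finite_variance mu) (tau0 : 0 < tau).

Lemma G_sphere_ge (a : R) n k : (k <= n)%N ->
  (1 + expR (- (tau * a))) ^+ n <=
    n.+1%:R * ('C(n, k)%:R * expR (- (tau * a)) ^+ k) ->
  n%:R * g mu tau a - ln n.+1%:R <= G mu (hamming_sphere k n) tau.
Proof.
move=> kn mode; rewrite gE /G card_sphere.
have hG := ler_wpM2l (ltW tau0) (Gamma_sphere_le fv a kn).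
have C0 : 0 < 'C(n, k)%:R :> R by rewrite ltr0n bin_gt0.
move: mode; rewrite -ler_ln ?posrE; last 2 first.
- by rewrite exprn_gt0// ln1pexp_gt0.
- by rewrite mulr_gt0 ?ltr0n// mulr_gt0// exprn_gt0// expR_gt0.
rewrite lnXn ?ln1pexp_gt0// lnM ?posrE ?mulr_gt0 ?exprn_gt0 ?expR_gt0//.
rewrite lnM ?posrE ?exprn_gt0 ?expR_gt0// lnXn ?expR_gt0// expRK.
rewrite -(mulr_natl (ln _)) -(mulr_natl (- _)).
move: hG; lra.
Qed.

(** As d is arbitrary, this makes ln (n + 1) negligible compared with n. *)
Lemma ln_succ_le (d : R) n : 0 < d -> ln n.+1%:R <= d * n%:R + d^-1.
Proof.
move=> d0; have dV : 0 < d^-1 by rewrite invr_gt0.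
have dn : 0 <= d * n%:R by rewrite mulr_ge0// ltW.
have p1 : 0 < 1 + d * n%:R by lra.
have p2 : 0 < 1 + d^-1 by lra.
apply: (@le_trans _ _ (ln ((1 + d * n%:R) * (1 + d^-1)))).
  rewrite ler_ln ?posrE ?ltr0n ?mulr_gt0// -natr1.
  have -> : (1 + d * n%:R) * (1 + d^-1) = 1 + n%:R + d * n%:R + d^-1.
    by field; rewrite gt_eqF.
  lra.
rewrite lnM ?posrE// lerD// le_ln1Dx//; lra.
Qed.

Lemma G_sphere_cvg (a : R) (k : nat -> nat) :
  (forall n, (0 < n)%N ->
    G mu (hamming_sphere (k n) n) tau <= n%:R * g mu tau a) ->
  (forall n, n%:R * g mu tau a - ln n.+1%:R <=
    G mu (hamming_sphere (k n) n) tau) ->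
  G mu (hamming_sphere (k n) n) tau / n%:R @[n --> \oo] --> g mu tau a.
Proof.
move=> Gle Gge; apply/cvgrPdist_le => e e0.
near=> n.
have n0 : (0 < n)%N by near: n; exact: nbhs_infty_gt.
have nR : 0 < n%:R :> R by rewrite ltr0n.
pose d := e / 2; have d0 : 0 < d by rewrite divr_gt0.
have nd : d^-1 / d <= n%:R by near: n; exact: nbhs_infty_ger.
rewrite -(ler_pM2r nR) -[X in _ * X <= _](gtr0_norm nR) -normrM mulrBl.
rewrite divfK ?gt_eqF//.
rewrite ger0_norm; last by rewrite subr_ge0 mulrC Gle.
have := Gge n; have := ln_succ_le n d0.
move: nd; rewrite ler_pdivrMr// (_ : e = d + d); last by rewrite /d; lra.
lra.
Unshelve. all: by end_near.
Qed.

End lower_bound.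

(** * First-order condition at a maximizer of g *)

Section stationarity.
Context {R : realType}.
Variables (mu : probability (measurableTypeR R) R) (tau : R).
Hypotheses (fv : finite_variance mu) (tau0 : 0 < tau).

(** Tangent line at x of the convex function ln (1 + e^x). After taking
    exponentials, with p the slope and u = y - x, it reads
    e^(p u) <= 1 - p + p e^u; dividing by e^(p u), this is the average with
    weights 1 - p and p of the bound 1 + v <= e^v at v = - p u and
    v = (1 - p) u. *)
Lemma ln1pexp_tangent (x y : R) :
  ln (1 + expR x) + expR x / (1 + expR x) * (y - x) <= ln (1 + expR y).
Proof.
set p := expR x / (1 + expR x); set u := y - x.
have p0 : 0 <= p by rewrite divr_ge0 ?expR_ge0 ?(ltW (ln1pexp_gt0 _)).
have p1 : 0 <= 1 - p.
  by rewrite subr_ge0 ler_pdivrMr ?ln1pexp_gt0// mul1r lerDr.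
rewrite -ler_expR expRD !lnK ?posrE ?ln1pexp_gt0//.
have -> : 1 + expR y = (1 + expR x) * ((1 - p) + p * expR u).
  rewrite /u expRB /p; field; rewrite !gt_eqF ?ln1pexp_gt0 ?expR_gt0//.
rewrite ler_pM2l ?ln1pexp_gt0//.
have -> : 1 - p + p * expR u = expR (p * u) *
    ((1 - p) * expR (- (p * u)) + p * expR ((1 - p) * u)).
  rewrite mulrDr mulrCA expRxMexpNx_1 mulr1 [X in _ = _ + X]mulrCA -expRD.
  by congr (_ + _ * expR _); ring.
rewrite ler_pMr ?expR_gt0//.
have h1 := ler_wpM2l p1 (expR_ge1Dx (- (p * u))).
have h2 := ler_wpM2l p0 (expR_ge1Dx ((1 - p) * u)).
apply: le_trans (lerD h1 h2); lra.
Qed.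

(** At a maximizer a, comparing the tangent line of ln (1 + e^x) with the
    subgradient of the mean excess at b gives
    (a - b) p <= (a - b) (1 - F b) for every b, where p is the right-hand side.
    Letting b tend to a from either side yields both inequalities. *)
Lemma tail_at_maximizer (a : R) : continuous (F mu) ->
  (forall b, g mu tau b <= g mu tau a) ->
  1 - F mu a = expR (- (tau * a)) / (1 + expR (- (tau * a))).
Proof.
move=> cF amax; set p := RHS.
have key b : (a - b) * p <= (a - b) * (1 - F mu b).
  have := amax b; rewrite !gE.
  have := ln1pexp_tangent (- (tau * a)) (- (tau * b)); rewrite -/p.
  have := ler_wpM2l (ltW tau0) (mean_excess_subgradient fv a b).
  move=> h1 h2 h3; rewrite -(ler_pM2l tau0); move: h1 h2 h3; lra.
apply/eqP; rewrite eq_le; apply/andP; split.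
  rewrite lerBlDl -lerBlDr.
  apply: (@cvgr_to_ge _ _ _ _ (F mu) _ _ (cvg_at_right_filter (cF a))).
  near=> b; have ab : a < b by near: b; exact: nbhs_right_gt.
  by have := key b; rewrite ler_nM2l ?subr_lt0//; lra.
rewrite lerBrDl -lerBrDr.
apply: (@cvgr_to_le _ _ _ _ (F mu) _ _ (cvg_at_left_filter (cF a))).
near=> b; have ab : b < a by near: b; exact: nbhs_left_lt.
by have := key b; rewrite ler_pM2l ?subr_gt0//; lra.
Unshelve. all: by end_near.
Qed.

End stationarity.

Theorem theorem4p2 (R : realType) (mu : probability (measurableTypeR R) R)
    (tau : R) :
  symmetric_measure mu -> finite_variance mu -> 0 < tau ->
  (forall (n : nat) (X : {set n.-tuple bool}), (1 <= n)%N -> X != finset.set0 ->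
     G mu X tau <= n%:R * sup [set g mu tau a | a in [set a | 0 <= a]]) /\
  (forall a0 : R, 0 <= a0 ->
     sup [set g mu tau a | a in [set a | 0 <= a]] = g mu tau a0 ->
     0 < g mu tau a0 ->
     (exists k : nat -> nat,
        (forall n, (k n <= n)%N) /\
        G mu (hamming_sphere (k n) n) tau / n%:R @[n --> \oo]
          --> g mu tau a0) /\
     (continuous (F mu) -> {homo F mu : s t / s < t} ->
      exists k : nat -> nat,
        [/\ (forall n, (k n <= n)%N),
            G mu (hamming_sphere (k n) n) tau / n%:R @[n --> \oo]
              --> g mu tau a0 &
            (fun n => (k n)%:R : R) =
              (fun n => (1 - F mu a0) * n%:R : R) +o_\oo (fun n => n%:R : R)])).
Proof.
move=> sym fv tau0.
have gs := g_le_sup sym fv tau0.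
have upper n (X : {set n.-tuple bool}) : X != finset.set0 ->
    G mu X tau <= n%:R * sup [set g mu tau a | a in [set a | 0 <= a]].
  by apply: G_le => //; exact: sup_g_ge0.
split=> [n X _|a0 _ supE _]; first exact: upper.
rewrite supE in gs upper.
have [k kP] := choice (binomial_mode (expR_gt0 (- (tau * a0)))).
have kn n : (k n <= n)%N by case: (kP n).
have kcvg :
    G mu (hamming_sphere (k n) n) tau / n%:R @[n --> \oo] --> g mu tau a0.
  apply: G_sphere_cvg => n; first by move=> _; apply/upper/sphere_neq0.
  by case: (kP n) => _ mode _; exact: G_sphere_ge.
split; first by exists k.
move=> cF _; exists k; split => //.
apply/eqaddoP => e e0; near=> n.
rewrite /= (tail_at_maximizer fv tau0 cF gs).
case: (kP n) => _ _ /le_trans; apply.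
rewrite normr_nat -ler_pdivrMl// mulr1.
by near: n; exact: nbhs_infty_ger.
Unshelve. all: by end_near.
Qed.
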